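(* Let $a,b\in K$ satisfy $0<|a|<1$ and $|b|=q$, let $T:K^2\to K^2$ be $T(x,y)=(ay+b(x^q-x),\,x)$, and let $\mathcal{A}_T=\bigcap_{n\ge1}T^n(R^2)$. Then $\mathcal{A}_T$ has Hausdorff dimension $$\dim\mathcal{A}_T=1+\frac{1}{1+\log_q(1/|a|)}.$$
   Context: $K$ is a field that is complete and locally compact with respect to a nontrivial non-Archimedean absolute value $|\cdot|$. $R=\{x\in K: |x|\le 1\}$ is its ring of integers, $\pi\in R$ is a uniformizing parameter, $\mathbb{F}=R/\pi R$ is the (finite) residue field, and $q=|\mathbb{F}|$. The absolute value is normalized so that $|\pi|=1/q$. Hausdorff dimension is taken with respect to the metric on $K^2$ induced by the norm $\|(x,y)\|=\max(|x|,|y|)$: $\mathcal{H}_{p,\delta}(A)=\inf\sum_j\mathrm{diam}(B_j)^p$ over all countable covers $\{B_j\}$ of $A$ with $\mathrm{diam}(B_j)\le\delta$, $\mathcal{H}_p(A)=\lim_{\delta\to0}\mathcal{H}_{p,\delta}(A)$, and $\dim A$ is the unique nonnegative real number with $\mathcal{H}_p(A)=0$ for all $p>\dim A$ and $\mathcal{H}_p(A)=+\infty$ for all $p<\dim A$. *)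

(* Defs.v *)
From HB Require Import structures.
From mathcomp Require Import all_boot all_order all_algebra.
From mathcomp Require Import ring_quotient.
From mathcomp Require Import all_classical all_reals all_analysis.

Set Implicit Arguments.
Unset Strict Implicit.
Unset Printing Implicit Defensive.
Import Order.TTheory GRing.Theory Num.Theory.
Import numFieldNormedType.Exports.

Local Open Scope classical_set_scope.
Local Open Scope ring_scope.

HB.mixin Record isNonArchAbs (R : realType) K & GRing.Field K := {
  absv : K -> R ;
  absv_ge0 : forall x : K, 0 <= absv x ;
  absv_eq0 : forall x : K, (absv x == 0) = (x == 0) ;
  absvM : forall x y : K, absv (x * y) = absv x * absv y ;
  absvD_max : forall x y : K, absv (x + y) <= Num.max (absv x) (absv y)
}.

#[short(type="nonArchFieldType")]
HB.structure Definition NonArchField (R : realType) :=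
  {K of GRing.Field K & isNonArchAbs R K}.

Definition nontrivial_absv (R : realType) (K : nonArchFieldType R) :=
  exists2 x : K, x != 0 & absv x != 1.

Section AbsoluteValueMetric.
Variables (R : realType) (K : nonArchFieldType R).

Lemma absv0 : absv (0 : K) = 0.
Proof. by apply/eqP; rewrite absv_eq0. Qed.

Lemma absv1 : absv (1 : K) = 1.
Proof.
have n0 : absv (1 : K) != 0 by rewrite absv_eq0 oner_eq0.
by apply: (mulfI n0); rewrite -absvM !mulr1.
Qed.

Lemma absvN (x : K) : absv (- x) = absv x.
Proof.
have h : absv (-1 : K) = 1.
  apply/eqP; rewrite -sqrp_eq1 ?absv_ge0// expr2 -absvM mulrNN mulr1.
  by rewrite absv1.
by rewrite -mulN1r absvM h mul1r.
Qed.

Lemma absv_dist_triangle (y x z : K) :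
  absv (x - z) <= absv (x - y) + absv (y - z).
Proof.
rewrite -[x - z](subrKA y) (le_trans (absvD_max _ _))// ge_max.
by rewrite lerDl lerDr !absv_ge0.
Qed.

(* K and K^2 as metric spaces. They are aliases because the library lacks the
   join of its metric structures with the algebraic ones, except for
   [PseudoMetricNormedZmod], whose norms satisfy [`|x *+ n| = `|x| *+ n] and
   so are not non-Archimedean. *)
Definition abs_space : Type := K.
HB.instance Definition _ := Choice.on abs_space.
HB.instance Definition _ := isPointed.Build abs_space (0 : K).

Let dist1 (x y : abs_space) : R := absv ((x : K) - y).

Let dist1xx x : dist1 x x = 0.
Proof. by rewrite /dist1 subrr absv0. Qed.

Let dist1_positivity x y : dist1 x y = 0 -> x = y.
Proof. by move/eqP; rewrite absv_eq0 subr_eq0 => /eqP. Qed.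

Let dist1_sym x y : dist1 x y = dist1 y x.
Proof. by rewrite /dist1 -absvN opprB. Qed.

Let dist1_triangle y x z : dist1 x z <= dist1 x y + dist1 y z.
Proof. exact: absv_dist_triangle. Qed.

HB.instance Definition _ := isMetric.Build R abs_space
  dist1xx dist1_positivity dist1_sym dist1_triangle.

Definition abs_plane : Type := (K * K)%type.
HB.instance Definition _ := Choice.on abs_plane.

Definition normK2 (u : K * K) : R := Num.max (absv u.1) (absv u.2).

Let dist2 (u v : abs_plane) : R := normK2 ((u : K * K) - v).

Let dist2xx u : dist2 u u = 0.
Proof. by rewrite /dist2 subrr /normK2/= absv0 maxxx. Qed.

Let dist2_positivity u v : dist2 u v = 0 -> u = v.
Proof.
case: u v => [u1 u2] [v1 v2]; rewrite /dist2 /normK2/= => e.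
have := lexx (Num.max (absv (u1 - v1)) (absv (u2 - v2))).
rewrite {2}e ge_max => /andP[h1 h2]; congr pair.
- by apply/eqP; rewrite -subr_eq0 -absv_eq0 eq_le h1 absv_ge0.
- by apply/eqP; rewrite -subr_eq0 -absv_eq0 eq_le h2 absv_ge0.
Qed.

Let dist2_sym u v : dist2 u v = dist2 v u.
Proof.
by rewrite /dist2 /normK2/= -absvN opprB -[X in Num.max _ X]absvN opprB.
Qed.

Let dist2_triangle v u w : dist2 u w <= dist2 u v + dist2 v w.
Proof.
rewrite /dist2 /normK2/= ge_max.
by apply/andP; split;
  [apply: le_trans (absv_dist_triangle v.1 _ _) _
  |apply: le_trans (absv_dist_triangle v.2 _ _) _];
  apply: lerD; rewrite le_max lexx ?orbT.
Qed.

HB.instance Definition _ := isMetric.Build R abs_plane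
  dist2xx dist2_positivity dist2_sym dist2_triangle.

(* What [Uniform_isComplete] asks for, as a proposition. *)
Definition complete_absv : Prop :=
  forall F : set_system abs_space, ProperFilter F -> cauchy F -> cvg F.

End AbsoluteValueMetric.

Section ValuationRing.
Variables (R : realType) (K : nonArchFieldType R).

Definition valuation_pred : {pred K} := [pred x | absv x <= 1].

Lemma valuation_subring_closed : subring_closed valuation_pred.
Proof.
split; first by rewrite inE absv1.
- move=> x y; rewrite !inE => x1 y1.
  by rewrite (le_trans (absvD_max _ _))// ge_max x1 absvN.
- move=> x y; rewrite !inE => x1 y1.
  by rewrite absvM mulr_ile1 ?absv_ge0.
Qed.

HB.instance Definition _ :=
  GRing.isSubringClosed.Build K valuation_pred valuation_subring_closed.

Definition valuation_ring := {x : K | x \in valuation_pred}.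

HB.instance Definition _ := SubChoice.on valuation_ring.
HB.instance Definition _ :=
  [SubChoice_isSubComNzRing of valuation_ring by <:].

Record uniformizer := Uniformizer {
  unif :> valuation_ring ;
  unif_lt1 : absv (\val unif) < 1 ;
  unif_gen : forall x : valuation_ring,
    absv (\val x) < 1 -> exists y, x = unif * y
}.

Definition unif_ideal (w : uniformizer) : {pred valuation_ring} :=
  [pred x | `[< exists y, x = unif w * y >]].

Lemma unif_ideal_closed (w : uniformizer) : idealr_closed (unif_ideal w).
Proof.
split.
- by apply/asboolP; exists 0; rewrite mulr0.
- apply/asboolPn => -[y /(congr1 \val) e].
  have : absv (\val (unif w) * \val y) < 1.
    rewrite absvM; apply: le_lt_trans (unif_lt1 w).
    by rewrite ler_piMr ?absv_ge0//; exact: (valP y).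
  by have -> : \val (unif w) * \val y = 1 by []; rewrite absv1 ltxx.
- move=> a x y /asboolP[x' ->] /asboolP[y' ->].
  by apply/asboolP; exists (a * x' + y'); rewrite mulrDr mulrCA.
Qed.

HB.instance Definition _ (w : uniformizer) :=
  isIdealr.Build valuation_ring (unif_ideal w) (unif_ideal_closed w).

Definition residue_field (w : uniformizer) := {ideal_quot (unif_ideal w)}.

Definition unit_bidisk : set (K * K) :=
  [set u | u.1 \in valuation_pred /\ u.2 \in valuation_pred].

Definition henon_map (q : nat) (a b : K) (u : K * K) : K * K :=
  (a * u.2 + b * (u.1 ^+ q - u.1), u.1).

Definition attractor (T : K * K -> K * K) : set (abs_plane K) :=
  \bigcap_(n in [set n | (1 <= n)%N]) (iter n T @` unit_bidisk).

End ValuationRing.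

Section Hausdorff.
Local Open Scope ereal_scope.
Variables (R : realType) (X : metricType R).

(* The maximum with 0 only matters for the empty set. *)
Definition diam (B : set X) : \bar R :=
  maxe 0 (ereal_sup [set (mdist x y)%:E | x in B & y in B]).

(* Covers are indexed by a subset [J] of nat, so that finite covers need no
   padding with empty sets: [0 `^ 0 = 1], and [p = 0] gives counting measure. *)
Definition hausdorff_content (p delta : R) (A : set X) : \bar R :=
  ereal_inf [set s | exists (J : set nat) (B : nat -> set X),
    [/\ A `<=` \bigcup_(j in J) B j,
        forall j, J j -> diam (B j) <= delta%:E &
        s = \esum_(j in J) (diam (B j) `^ p)]].

Definition hausdorff_measure (p : R) (A : set X) : \bar R :=
  lim (hausdorff_content p delta A @[delta --> (0%R : R)^'+]).

Definition hausdorff_dim (A : set X) (d : R) : Prop :=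
  [/\ (0 <= d)%R,
      forall p, (d < p)%R -> hausdorff_measure p A = 0 &
      forall p, (0 <= p < d)%R -> hausdorff_measure p A = +oo].

Lemma hausdorff_dim_unique (A : set X) (d d' : R) :
  hausdorff_dim A d -> hausdorff_dim A d' -> d = d'.
Proof.
have lt_false e f : (e < f)%R -> hausdorff_dim A e -> hausdorff_dim A f -> False.
  move=> ef [e0 he _] [_ _ hf].
  have := he _ (midf_lt ef).1; rewrite hf//.
  by rewrite (midf_lt ef).2 andbT ltW// (le_lt_trans e0)// (midf_lt ef).1.
move=> hd hd'; case: (ltgtP d d') => // h.
- by case: (lt_false _ _ h hd hd').
- by case: (lt_false _ _ h hd' hd).
Qed.

End Hausdorff.

(* Main.v *)
(* As [pi] generates the maximal ideal, [|a| = q^-m] with [m >= 1]; put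
   [M = m + 1], so that the claimed dimension is [(M + 1) / M].  The points of
   the attractor are the pairs [(x 0, x 1)] where [x] is a backward orbit: all
   [x n] are in the valuation ring and
   [x n = a * x (n+2) + b * (x (n+1) ^ q - x (n+1))].  The value [x 0] and the
   residues of [x 1, x 2, ...] determine [x] and can be prescribed arbitrarily:
   as [t ^ q] is congruent to [t] and [t |-> t ^ q] contracts each residue
   class, rewriting the equation as
   [x (n+1) = x (n+1) ^ q + (a * x (n+2) - x n) / b] makes [x] the fixed point
   of a contraction.
   Moreover two points of the attractor are at distance at most [q^-(M n)] iff
   the first [M n] digits of their [x 0] and the residues of their
   [x 1, ..., x n] agree.  Interleaving these data codes the attractor
   by the sequences of digits below [q] in such a way that the first
   [(M + 1) n] digits determine the ball of radius [q^-(M n)], and conversely.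
   The upper bound on the dimension counts these balls; for the lower bound,
   the base [q] digits of a real number give a map from [0, 1[ to the attractor,
   through which covers of the attractor become covers of [0, 1[, and Lebesgue
   measure is countably subadditive. *)
Require Import Defs.
From mathcomp Require Import all_boot all_order all_algebra.
From mathcomp Require Import all_classical all_reals all_analysis.
From mathcomp Require Import generic_quotient ring_quotient ring lra.

Set Implicit Arguments.
Unset Strict Implicit.
Unset Printing Implicit Defensive.

Import Order.TTheory GRing.Theory Num.Theory.
Local Open Scope classical_set_scope.
Local Open Scope ring_scope.

(** * Base [q] expansions of reals in the unit interval *)

Section RealDigits.
Variables (R : realType) (q : nat).

Definition real_shift (t : R) : R := q%:R * t - (Num.truncn (q%:R * t))%:R.

Definition real_digit (t : R) (i : nat) : nat :=
  Num.truncn (q%:R * iter i real_shift t).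

Lemma real_shift_itv t : 0 <= t < 1 -> 0 <= real_shift t < 1.
Proof.
move=> /andP[t0 _].
have /truncn_itv/andP[lo hi] : 0 <= q%:R * t by rewrite mulr_ge0.
by rewrite /real_shift subr_ge0 lo ltrBlDl natr1.
Qed.

Lemma iter_real_shift_itv t i : 0 <= t < 1 -> 0 <= iter i real_shift t < 1.
Proof. by move=> t01; elim: i => //= i; exact: real_shift_itv. Qed.

Lemma real_digit_lt t i : (0 < q)%N -> 0 <= t < 1 -> (real_digit t i < q)%N.
Proof.
move=> q0 /(iter_real_shift_itv i)/andP[s0 s1].
rewrite /real_digit truncn_lt_nat ?mulr_ge0//.
by rewrite gtr_pMr ?ltr0n.
Qed.

(** As long as the digits agree, each shift multiplies the difference by [q], and after [n] shifts
    both points still lie in the unit interval. *)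
Lemma real_digit_inj t t' n : (0 < q)%N -> 0 <= t < 1 -> 0 <= t' < 1 ->
  (forall i, (i < n)%N -> real_digit t i = real_digit t' i) ->
  `|t - t'| <= q%:R ^- n.
Proof.
move=> q0 t01 t'01 dE; have qR0 : 0 < q%:R :> R by rewrite ltr0n.
suff -> : t - t' = (iter n real_shift t - iter n real_shift t') / q%:R ^+ n.
  rewrite normrM normfV [X in _ / X]gtr0_norm ?exprn_gt0//.
  rewrite ler_piMl ?invr_ge0 ?exprn_ge0//.
  have /andP[h1 h2] := iter_real_shift_itv n t01.
  have /andP[h3 h4] := iter_real_shift_itv n t'01.
  by rewrite ler_norml; lra.
elim: n dE => [|n IH] dE; first by rewrite expr0 divr1.
rewrite {1}IH; last by move=> i /ltnW; exact: dE.
have := dE n (ltnSn n); rewrite /real_digit => e.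
rewrite /= /real_shift e exprS; field.
by rewrite expf_neq0 gt_eqF.
Qed.

End RealDigits.

(** * Diameters, Hausdorff contents and Hausdorff measures *)

Section Diameter.
Local Open Scope ereal_scope.
Variables (R : realType) (X : metricType R).
Implicit Types (A B : set X).

Lemma diam_ge0 B : 0 <= diam B.
Proof. by rewrite /diam le_max lexx. Qed.

Lemma mdist_le_diam B x y : B x -> B y -> (mdist x y)%:E <= diam B.
Proof.
move=> Bx By; rewrite /diam le_max; apply/orP; right.
by apply: ereal_sup_ubound; exists x => //; exists y.
Qed.

Lemma diam_le B (e : R) : (0 <= e)%R ->
  (forall x y, B x -> B y -> (mdist x y <= e)%R) -> diam B <= e%:E.
Proof.
move=> e0 Be; rewrite /diam ge_max lee_fin e0/=.
by apply: ge_ereal_sup => _ [x Bx [y By <-]]; rewrite lee_fin Be.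
Qed.

Lemma hausdorff_content_ge0 p delta A : 0 <= hausdorff_content p delta A.
Proof.
apply: le_ereal_inf_tmp => _ [J [B [_ _ ->]]].
by apply: esum_ge0 => j _; exact: poweR_ge0.
Qed.

(** The cover consists of the fibres of [code] in [A], one for each element of [T]; an empty fibre
    has diameter 0, which [e] bounds too. *)
Lemma hausdorff_content_le_card (T : finType) (code : X -> T) p delta e A :
  (0 <= p)%R -> (0 <= e <= delta)%R ->
  (forall x y, A x -> A y -> code x = code y -> (mdist x y <= e)%R) ->
  hausdorff_content p delta A <= (#|T|%:R * e `^ p)%:E.
Proof.
move=> p0 /andP[e0 ed] codeE.
pose B j := [set x | A x /\ enum_rank (code x) = j :> nat].
have diamB j : diam (B j) <= e%:E.
  apply: diam_le => // x y [Ax xj] [Ay yj]; apply: codeE => //.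
  by apply/enum_rank_inj/val_inj; rewrite /= xj yj.
apply: (@le_trans _ _ (\esum_(j in `I_#|T|) (diam (B j) `^ p))).
  apply: ereal_inf_lbound; exists `I_#|T|, B; split=> // [x Ax|j _].
    by exists (enum_rank (code x)) => //; rewrite /= ltn_ord.
  by apply: le_trans (diamB j) _; rewrite lee_fin.
apply: (@le_trans _ _ (\esum_(j in `I_#|T|) (e `^ p)%:E)).
  apply: le_esum => j _; rewrite -poweR_EFin gt0_ler_poweR// ?in_itv/=.
  - by rewrite diam_ge0 leey.
  - by rewrite lee_fin e0 leey.
rewrite esum_fset//; last by move=> j _; rewrite lee_fin powR_ge0.
by rewrite -fsbig_ord sumEFin lee_fin sumr_const card_ord mulr_natl.
Qed.

Lemma le_hausdorff_content p A (d e : R) : (d <= e)%R ->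
  hausdorff_content p e A <= hausdorff_content p d A.
Proof.
move=> de; apply: ereal_inf_le_tmp => _ [J [B [AB Bd ->]]].
exists J, B; split=> // j Jj.
by apply: le_trans (Bd _ Jj) _; rewrite lee_fin.
Qed.

Lemma hausdorff_measure_eq0 p A :
  (forall d : R, (0 < d)%R -> hausdorff_content p d A <= 0) ->
  hausdorff_measure p A = 0.
Proof.
move=> h; apply: lim_near_cst => //.
near=> d; apply/eqP; rewrite eq_le hausdorff_content_ge0 andbT.
by apply: h; near: d; exact: nbhs_right_gt.
Unshelve. all: by end_near. Qed.

(** Shrinking the scale only raises the content, so a lower bound found at one scale survives in the
    limit. *)
Lemma hausdorff_measure_eqy p A :
  (forall c : R, exists2 d : R, (0 < d)%R & c%:E <= hausdorff_content p d A) ->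
  hausdorff_measure p A = +oo.
Proof.
move=> h; apply: cvg_lim => //; apply/cvgeyPge => c.
have [d d0 cd] := h c.
near=> e; apply: le_trans cd _; apply: le_hausdorff_content.
by near: e; exact: nbhs_right_le.
Unshelve. all: by end_near. Qed.

End Diameter.

(* The sets [P j] need not be measurable, only of bounded width. *)
Lemma sum_width_cover_ge1 (R : realType) (J : set nat) (P : nat -> set R)
    (l : nat -> \bar R) :
  [set t | 0 <= t < 1] `<=` \bigcup_(j in J) P j ->
  (forall j, J j -> exists w : R, [/\ 0 <= w, ((2 * w)%:E <= l j)%E &
     forall t t', P j t -> P j t' -> `|t - t'| <= w]) ->
  (1 <= \esum_(j in J) l j)%E.
Proof.
move=> cov lP.
have int j : exists I : set R, measurable I /\
    (J j -> P j `<=` I /\ (lebesgue_measure I <= l j)%E).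
  have [Jj|nJ] := pselect (J j); last by exists set0; split.
  have [w [w0 wl Pw]] := lP j Jj.
  have [[s Ps]|Pn] := pselect (exists s, P j s); last first.
    exists set0; split => // _; split; first by move=> t Pt; case: Pn; exists t.
    by rewrite measure0; apply: le_trans wl; rewrite lee_fin mulr_ge0.
  (* An interval of radius [w] about any point of [P j] contains [P j]; its length is the [2 * w] of
     the hypothesis. *)
  exists `[s - w, s + w]%classic; split => // _; split.
    move=> t Pt; rewrite /= in_itv/=.
    by have := Pw _ _ Ps Pt; rewrite ler_distlC.
  rewrite lebesgue_measure_itv/= lte_fin; case: ifP => _; last first.
    by apply: le_trans wl; rewrite lee_fin mulr_ge0.
  by apply: le_trans wl; rewrite -EFinD lee_fin; lra.
have [I mI] := choice int.
pose I' j := if j \in J then I j else set0.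
have mI' j : measurable (I' j) by rewrite /I'; case: ifP => // _; exact: (mI j).1.
have <- : lebesgue_measure (`[0, 1[%classic : set R) = 1%E.
  by rewrite lebesgue_measure_itv/= lte_fin ltr01 -EFinD subr0.
apply: (@le_trans _ _ (\sum_(0 <= j <oo) lebesgue_measure (I' j))%E).
  apply: measure_sigma_subadditive => //.
  move=> t; rewrite /= in_itv/= => /cov[j Jj Pjt]; exists j => //.
  by rewrite /I' mem_set//; apply: ((mI j).2 Jj).1.
rewrite nneseries_esumT//= esum_mkcond [leRHS]esum_mkcond.
apply: le_esum => j _; rewrite in_setT /I'.
case: ifP => [/set_mem Jj|]; last by rewrite measure0.
by apply: ((mI j).2 Jj).2.
Qed.

Lemma expr_small (R : realType) (x e : R) : 0 <= x < 1 -> 0 < e ->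
  exists N, forall n, (N <= n)%N -> x ^+ n <= e.
Proof.
move=> /andP[x0 x1] e0.
have /cvg_expr/cvgrPdist_le/(_ e e0)[N _ hN] : `|x| < 1 by rewrite ger0_norm.
exists N => n Nn; have := hN n Nn.
by rewrite sub0r normrN ger0_norm// exprn_ge0.
Qed.

Lemma powR_exprVn (R : realType) (x : R) n r :
  0 <= x -> (x ^- n) `^ r = x `^ (- (n%:R * r)).
Proof.
by move=> x0; rewrite powRN powRrM powR_mulrn// -powR_inv1 ?exprn_ge0//
  -powRrM mulN1r powRN.
Qed.

Lemma esumZl (R : realType) (J : set nat) (a : nat -> \bar R) (c : R) :
  0 <= c -> (forall j, (0 <= a j)%E) ->
  (\esum_(j in J) (c%:E * a j) = c%:E * \esum_(j in J) a j)%E.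
Proof.
move=> c0 a0; rewrite -(set_mem_set J) -!nneseries_esum//.
  by rewrite nneseriesZl.
by move=> j _; rewrite mule_ge0.
Qed.

(** * Hausdorff dimension of a set coded by digit sequences *)

Section CodedSets.
Variables (R : realType) (X : metricType R) (A : set X) (q L M : nat).
Variable dig : X -> nat -> nat.
Hypotheses (q_gt1 : (1 < q)%N) (L_gt0 : (0 < L)%N) (M_gt0 : (0 < M)%N).
Hypothesis dig_lt : forall x i, (dig x i < q)%N.
Hypothesis dig_mdist : forall n x y, A x -> A y ->
  (forall i, (i < L * n)%N -> dig x i = dig y i) ->
  mdist x y <= q%:R ^- (M * n).
Hypothesis mdist_dig : forall n x y, A x -> A y ->
  mdist x y <= q%:R ^- (M * n) ->
  forall i, (i < L * n)%N -> dig x i = dig y i.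
Hypothesis dig_surj : forall c : nat -> nat, (forall i, (c i < q)%N) ->
  exists2 x, A x & forall i, dig x i = c i.

Let Q : R := q%:R.

Let Q_gt1 : 1 < Q. Proof. by rewrite /Q ltr1n. Qed.
Let Q_gt0 : 0 < Q. Proof. exact: lt_trans Q_gt1. Qed.
Let Q_ge0 : 0 <= Q. Proof. exact: ltW. Qed.
Let MR_gt0 : 0 < M%:R :> R. Proof. by rewrite ltr0n. Qed.

Let mesh_small e : 0 < e -> exists N, forall n, (N <= n)%N -> Q ^- (M * n) <= e.
Proof.
move=> e0; have Q1 : 0 <= Q^-1 < 1.
  by rewrite invr_ge0 Q_ge0/= invf_lt1.
have [N hN] := expr_small Q1 e0.
exists N => n Nn; rewrite -exprVn; apply: hN.
by rewrite (leq_trans Nn)// leq_pmull.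
Qed.

Let mesh_le m n : (m <= n)%N -> Q ^- (M * n) <= Q ^- (M * m).
Proof.
move=> mn; rewrite lef_pV2 ?posrE ?exprn_gt0//.
by rewrite ler_weXn2l ?ltW// leq_mul2l mn orbT.
Qed.

Let mesh_powR n p : (Q ^- (M * n)) `^ p = (Q `^ (- (M%:R * p))) ^+ n.
Proof.
rewrite powR_exprVn// -powR_mulrn ?powR_ge0// -powRrM.
by congr (_ `^ _); rewrite natrM; ring.
Qed.

Let powR_small r : r < 0 -> 0 <= Q `^ r < 1.
Proof.
move=> r0; rewrite powR_ge0/= /powR gt_eqF// expR_lt1.
by rewrite nmulr_rlt0// ln_gt0.
Qed.

(** Level [n] has [Q ^+ (L * n)] codes, whose cells have diameter at most [Q ^- (M * n)]. The
    resulting sum is the [n]-th power of [Q] to the exponent [L - M * p], a number below 1. *)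
Let content_upper p delta : L%:R / M%:R < p -> 0 < delta ->
  (hausdorff_content p delta A <= 0)%E.
Proof.
rewrite ltr_pdivrMr// => Lp d0.
have p0 : 0 <= p.
  by rewrite -(pmulr_lge0 _ MR_gt0) (le_trans _ (ltW Lp)).
apply/lee_addgt0Pr => e e0; rewrite add0e.
have /powR_small r1 : L%:R - M%:R * p < 0 by rewrite subr_lt0 mulrC.
have [N1 hN1] := expr_small r1 e0.
have [N2 hN2] := mesh_small d0.
pose n := maxn N1 N2.
pose code x := [ffun i : 'I_(L * n) => Ordinal (dig_lt x i)].
apply: (le_trans (@hausdorff_content_le_card _ _ _ code _ _ (Q ^- (M * n)) A p0 _ _)).
- by rewrite invr_ge0 exprn_ge0//= hN2// leq_maxr.
- move=> x y Ax Ay /ffunP cE; apply: dig_mdist => // i iLn.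
  by have := cE (Ordinal iLn); rewrite !ffunE => -[].
rewrite card_ffun !card_ord lee_fin mesh_powR natrX exprM -exprMn.
rewrite -[_ ^+ L]powR_mulrn// -powRD; last by rewrite (gt_eqF Q_gt0) implybT.
by apply: hN1; rewrite leq_maxl.
Qed.

(** This places a diameter [e] between consecutive mesh sizes: the upper one makes digits agree up
    to level [n], the lower one bounds the power of [e] from below. *)
Let mesh_bracket n0 e : 0 < e -> e <= Q ^- (M * n0) ->
  exists2 n, (n0 <= n)%N & Q ^- (M * n.+1) < e <= Q ^- (M * n).
Proof.
move=> e0 en0.
have exm : exists m, Q ^- (M * m) < e.
  have [N hN] := mesh_small (midf_lt e0).1.
  by exists N; apply: le_lt_trans (hN _ (leqnn _)) (midf_lt e0).2.
case: (ex_minnP exm) => m me mmin.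
have n0m : (n0 < m)%N.
  rewrite ltnNge; apply/negP => /mesh_le h.
  by have := lt_le_trans me (le_trans en0 h); rewrite ltxx.
case: m me mmin n0m => // n ne nmin n0n; exists n => //.
rewrite ne/= leNgt; apply/negP => /nmin.
by rewrite ltnn.
Qed.

(** From one level to the next, the number of cells grows by the first factor and the [p]-th power
    of the mesh changes by the second. *)
Let sigma_gt1 p : p < L%:R / M%:R -> 1 < Q ^+ L * Q `^ (- (M%:R * p)).
Proof.
rewrite ltr_pdivlMr// => pL; rewrite powRN ltr_pdivlMr ?powR_gt0// mul1r.
by rewrite -powR_mulrn// /powR !gt_eqF// ltr_expR ltr_pM2r ?ln_gt0// mulrC.
Qed.

(** The digits of reals give a map [g] from the unit interval to [A]. If the diameter of [B j] is
    bracketed at level [n], its preimage has width at most [Q ^- (L * n)], while the [p]-th power of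
    the diameter is at least [tau ^+ n.+1 = tau * sigma ^+ n * Q ^- (L * n)], and [n0 <= n]. The
    [/ 2] absorbs the factor 2 of [sum_width_cover_ge1]. *)
Let content_lower p n0 (tau := Q `^ (- (M%:R * p))) : 0 <= p < L%:R / M%:R ->
  ((tau * (Q ^+ L * tau) ^+ n0 / 2)%:E <=
   hausdorff_content p (Q ^- (M * n0)) A)%E.
Proof.
move=> /andP[p0 pL]; have tau0 : 0 < tau by rewrite powR_gt0.
have := sigma_gt1 pL; rewrite -/tau; set sigma := Q ^+ L * tau => sigma1.
have sigma0 : 0 < sigma by rewrite mulr_gt0 ?exprn_gt0.
have c0 : 0 < tau * sigma ^+ n0 / 2 by rewrite divr_gt0// mulr_gt0// exprn_gt0.
apply: le_ereal_inf_tmp => _ [J [B [AB Bd ->]]].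
have /choice[g gP] : forall t : R, exists x, 0 <= t < 1 ->
    A x /\ forall i, dig x i = real_digit q t i.
  move=> t.
  have [t01|nt] := boolP (0 <= t < 1).
    have [|x Ax xE] := dig_surj (c := real_digit q t).
      by move=> i; apply: real_digit_lt => //; exact: ltnW.
    by exists x.
  by have [|x _ _] := dig_surj (c := fun=> 0%N); [move=> _; exact: ltnW|exists x].
have g_mdist t t' n : 0 <= t < 1 -> 0 <= t' < 1 ->
    mdist (g t) (g t') <= Q ^- (M * n) -> `|t - t'| <= Q ^- (L * n).
  move=> t01 t'01; have [Ag gE] := gP t t01; have [Ag' gE'] := gP t' t'01.
  move=> /(mdist_dig Ag Ag') gg'; apply: real_digit_inj => //; first exact: ltnW.
  by move=> i iLn; rewrite -gE -gE' gg'.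
rewrite -[(_ / 2)%:E]mule1 -lee_pdivlMl//.
pose P j := [set t | 0 <= t < 1 /\ B j (g t)].
rewrite -esumZl; [|by rewrite invr_ge0 ltW|by move=> j; exact: poweR_ge0].
apply: (@sum_width_cover_ge1 _ J P).
  move=> t /= t01; have [/AB[j Jj Bj] _] := gP t t01.
  by exists j.
move=> j Jj; have := Bd j Jj.
have dfin : diam (B j) \is a fin_num.
  by rewrite ge0_fin_numE ?diam_ge0// (le_lt_trans (Bd j Jj))// ltry.
have Bdiam x y : B j x -> B j y -> mdist x y <= fine (diam (B j)).
  by move=> Bx By; rewrite -lee_fin fineK//; exact: mdist_le_diam.
rewrite -(fineK dfin) lee_fin; move: Bdiam.
have : 0 <= fine (diam (B j)) by rewrite fine_ge0 ?diam_ge0.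
set e := fine _; rewrite le_eqVlt => /predU1P[<-|e0] Bdiam een0.
  exists 0; split; first by [].
  - by rewrite mulr0 mule_ge0 ?poweR_ge0// lee_fin invr_ge0 ltW.
  - move=> t t' [t01 Bt] [t'01 Bt']; apply/ler_addgt0Pr => d d0; rewrite add0r.
    have [N /(_ _ (leqnn N)) hN] := mesh_small d0.
    (* Diameter 0 allows every level; at level [M * N] the exponent [L * (M * N)] is at least the
       [M * N] of the mesh that is known to be below [d]. *)
    apply: le_trans hN; apply: (@le_trans _ _ (Q ^- (L * (M * N)))).
      apply: g_mdist => //; apply: le_trans (Bdiam _ _ Bt Bt') _.
      by rewrite invr_ge0 exprn_ge0.
    rewrite lef_pV2 ?posrE ?exprn_gt0//.
    by rewrite ler_weXn2l ?ltW// leq_pmull.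
have [n n0n /andP[ne en]] := mesh_bracket e0 een0.
exists (Q ^- (L * n)); split; first by rewrite invr_ge0 exprn_ge0.
- rewrite lee_fin ler_pdivlMl//.
  apply: (@le_trans _ _ (tau ^+ n.+1)).
    have -> : tau ^+ n.+1 = tau * sigma ^+ n * Q ^- (L * n).
      rewrite exprS exprMn exprM; field.
      by rewrite !expf_neq0 ?gt_eqF.
    rewrite (_ : _ / 2 * _ = tau * sigma ^+ n0 * Q ^- (L * n)); last first.
      by field; rewrite expf_neq0 ?gt_eqF.
    rewrite ler_wpM2r ?invr_ge0 ?exprn_ge0// ler_pM2l//.
    by rewrite ler_weXn2l// ltW.
  rewrite -mesh_powR; apply: ge0_ler_powR => //; last exact: ltW.
  - by rewrite nnegrE invr_ge0 exprn_ge0.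
  - by rewrite nnegrE ltW.
- move=> t t' [t01 Bt] [t'01 Bt']; apply: g_mdist => //.
  by apply: le_trans (Bdiam _ _ Bt Bt') _.
Qed.

Lemma hausdorff_dim_coded : hausdorff_dim A (L%:R / M%:R).
Proof.
split; first by rewrite divr_ge0.
  by move=> p Lp; apply: hausdorff_measure_eq0 => d; exact: content_upper.
move=> p p0L; apply: hausdorff_measure_eqy => c.
set tau := Q `^ (- (M%:R * p)); set sigma := Q ^+ L * tau.
have tau0 : 0 < tau by rewrite powR_gt0.
have sigma1 : 1 < sigma by apply: sigma_gt1; case/andP: p0L.
have sigma0 : 0 < sigma := lt_trans ltr01 sigma1.
have cp : 0 < `|c| + 1 by rewrite ltr_wpDl.
(* This [N] makes the bound [tau * sigma ^+ N / 2] of [content_lower] reach [|c| + 1], where the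
   added 1 keeps the divisor positive. *)
have [||N /(_ N (leqnn N)) hN] := @expr_small R sigma^-1 (tau / 2 / (`|c| + 1)).
- by rewrite invr_ge0 ltW//= invf_lt1.
- by rewrite !divr_gt0.
exists (Q ^- (M * N)); first by rewrite invr_gt0 exprn_gt0.
apply: le_trans (content_lower N p0L); rewrite lee_fin -/tau -/sigma.
apply: (@le_trans _ _ (`|c| + 1)).
  by rewrite (le_trans (ler_norm c))// lerDl.
rewrite mulrAC -ler_pdivrMl ?divr_gt0// mulrC.
by rewrite -lef_pV2 ?posrE ?exprn_gt0 ?divr_gt0// -exprVn invf_div.
Qed.
End CodedSets.

(** Adding 1 permutes the elements, so comparing their sums gives [q%:R = 0]. Multiplying by a
    nonzero [x] permutes the nonzero elements, so comparing their products gives [x ^+ q.-1 = 1]. *)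
Lemma finite_field_frobenius (F : comNzRingType) (q : nat) :
  ([set: F] #= `I_q)%card -> (forall x : F, x != 0 -> exists y, x * y = 1) ->
  q%:R = 0 :> F /\ forall x : F, x ^+ q = x.
Proof.
move=> /card_set_bijP[f [fI finj fsurj]] Finv.
have f_lt x : (f x < q)%N by exact: fI.
pose r x := Ordinal (f_lt x).
have r_inj : injective r.
  by move=> x y [] /finj; apply; rewrite in_setT.
have /choice[e rK] : forall i : 'I_q, exists x, r x = i.
  by move=> i; have [x _ xi] := fsurj i (ltn_ord i); exists x; exact: val_inj.
have eK x : e (r x) = x by apply: r_inj; rewrite rK.
have e_inj : injective e by exact: can_inj rK.
split.
  have h_inj : injective (fun i => r (e i + 1)).
    by move=> i j /r_inj /addIr /e_inj.
  have : \sum_i e i = \sum_i (e i + 1).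
    by rewrite (reindex_inj h_inj)/=; apply: eq_bigr => i _; rewrite eK.
  rewrite big_split/= sumr_const card_ord -[LHS]addr0.
  by move/addrI/esym.
move=> x; have q0 : (0 < q)%N by exact: leq_ltn_trans (f_lt x).
have [->|x0] := eqVneq x 0; first by rewrite expr0n gtn_eqF.
have [y xy] := Finv x x0.
have xI : injective ( *%R x).
  by move=> u v /(congr1 ( *%R y)); rewrite !mulrA (mulrC y) xy !mul1r.
have h_inj : injective (fun i => r (x * e i)).
  by move=> i j /r_inj /xI /e_inj.
have [z Pz] : exists z, (\prod_(i | e i != 0) e i) * z = 1.
  apply: (big_ind (fun u => exists z, u * z = 1)) => //.
  - by exists 1; rewrite mulr1.
  - by move=> u v [u' uu'] [v' vv']; exists (u' * v'); rewrite mulrACA uu' vv' mulr1.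
  - by move=> i /Finv.
have : \prod_(i | e i != 0) e i = \prod_(i | e i != 0) (x * e i).
  rewrite (reindex_inj h_inj)/=; apply: eq_big => i; rewrite eK//.
  apply/idP/idP; apply: contra_neq; first by move=> ->; rewrite mulr0.
  by rewrite -{1}(mulr0 x) => /xI.
rewrite big_split/= prodr_const => /(congr1 ( *%R^~ z)).
rewrite -mulrA Pz mulr1 => /esym.
rewrite (_ : #|_| = q.-1) => [xq|].
  by rewrite -(prednK q0) exprS xq mulr1.
rewrite -[in RHS](card_ord q) -(cardC1 (r 0)); apply: eq_card => i.
by rewrite !inE -(inj_eq e_inj) eK.
Qed.

(** * Arithmetic of the residue field *)

Section ResidueField.
Variables (R : realType) (K : nonArchFieldType R) (w : uniformizer K).
Implicit Types x y : K.

Lemma absvB_max x y : absv (x - y) <= Num.max (absv x) (absv y).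
Proof. by rewrite -(absvN y); exact: absvD_max. Qed.

Lemma absvX x n : absv (x ^+ n) = absv x ^+ n.
Proof. by elim: n => [|n IH]; rewrite ?expr0 ?absv1// !exprS absvM IH. Qed.

Lemma absvV x : absv x^-1 = (absv x)^-1.
Proof.
have [->|x0] := eqVneq x 0; first by rewrite invr0 absv0 invr0.
have ax0 : absv x != 0 by rewrite absv_eq0.
by apply: (mulfI ax0); rewrite -absvM !mulfV// absv1.
Qed.

Local Open Scope quotient_scope.

Let F := {ideal_quot (unif_ideal w)}.

Lemma residue_eqP (u v : valuation_ring K) :
  reflect (\pi_F u = \pi_F v) (absv (\val u - \val v) < 1).
Proof.
apply: (iffP idP) => [uv|/eqP].
  apply/eqP; rewrite -Quotient.idealrBE; apply/asboolP.
  by have [y ->] := @unif_gen _ _ w (u - v) uv; exists y.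
rewrite -Quotient.idealrBE => /asboolP[y uv].
have -> : \val u - \val v = \val (unif w) * \val y by exact: (congr1 \val uv).
rewrite absvM.
apply: le_lt_trans (unif_lt1 w).
by rewrite ler_piMr ?absv_ge0//; exact: (valP y).
Qed.

(** A representative of a nonzero class has absolute value 1, so its inverse in [K] is again
    integral. *)
Lemma residue_inv (u : F) : u != 0 -> exists v, u * v = 1.
Proof.
rewrite -[u]reprK; set x := repr u => u0.
have x1 : absv (\val x) = 1.
  have x1 : absv (\val x) <= 1 := valP x.
  apply/eqP; rewrite eq_le x1 leNgt/=; apply: contra_neqN u0 => x_lt1.
  rewrite -[0](rmorph0 (\pi_F)); apply/residue_eqP.
  by rewrite rmorph0 subr0.
have xV : (\val x)^-1 \in @valuation_pred R K by rewrite inE absvV x1 invr1.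
exists (\pi_F (Sub (\val x)^-1 xV)).
rewrite -rmorphM -(rmorph1 \pi_F); congr (\pi_F _); apply: val_inj.
rewrite rmorphM/= mulfV//.
by rewrite -absv_eq0 x1 oner_eq0.
Qed.

Variable q : nat.
Hypothesis card_residue : ([set: residue_field w] #= `I_q)%card.

Lemma absv_card_lt1 : absv (q%:R : K) < 1.
Proof.
have [q0 _] := finite_field_frobenius card_residue residue_inv.
have : \pi_F q%:R = \pi_F 0 by rewrite rmorph_nat rmorph0.
by move/residue_eqP; rewrite rmorph_nat rmorph0 subr0.
Qed.

Lemma absv_frobenius_lt1 x : absv x <= 1 -> absv (x ^+ q - x) < 1.
Proof.
move=> x1; have [_ xq] := finite_field_frobenius card_residue residue_inv.
pose u : valuation_ring K := Sub x x1.
have : \pi_F (u ^+ q) = \pi_F u by rewrite rmorphXn xq.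
by move/residue_eqP; rewrite rmorphXn.
Qed.

(** Residues become numbers below [q] with chosen representatives, so that digits can be handled
    without the quotient ring. *)
Lemma residue_system : exists (res : K -> nat) (rep : nat -> K),
  [/\ forall x, (res x < q)%N, forall i, absv (rep i) <= 1,
      forall i, (i < q)%N -> res (rep i) = i &
      forall x y, absv x <= 1 -> absv y <= 1 ->
        res x = res y <-> absv (x - y) < 1].
Proof.
have /card_set_bijP[f [fI finj fsurj]] := card_residue.
(* Outside the valuation ring [lft] takes the value 0, which makes residues total on [K]. *)
pose lft x : valuation_ring K := insubd 0 x.
have lftK x : absv x <= 1 -> \val (lft x) = x by move=> x1; rewrite insubdK.
have /choice[rep repP] : forall i, exists x, absv x <= 1 /\
    ((i < q)%N -> f (\pi_F (lft x)) = i).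
  move=> i; have [iq|_] := boolP (i < q)%N; last by exists 0; rewrite absv0.
  have [u _ ui] := fsurj i iq.
  exists (\val (repr (u : F))); split; first exact: (valP (repr (u : F))).
  by move=> _; rewrite /lft valKd reprK.
exists (fun x => f (\pi_F (lft x))), rep; split.
- by move=> x; exact: fI.
- by move=> i; have [] := repP i.
- by move=> i; have [] := repP i.
- move=> x y x1 y1; split=> [/finj|xy].
    by rewrite !in_setT => /(_ isT isT) /residue_eqP; rewrite !lftK.
  by congr f; apply/residue_eqP; rewrite !lftK.
Qed.

End ResidueField.

(** * Ultrametric estimates and limits *)

Section Ultrametric.
Variables (R : realType) (K : nonArchFieldType R).
Implicit Types x y z : K.

Lemma absv_distC x y : absv (x - y) = absv (y - x).
Proof. by rewrite -absvN opprB. Qed.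

Lemma absv_dist_max y x z :
  absv (x - z) <= Num.max (absv (x - y)) (absv (y - z)).
Proof. by rewrite -[x - z](subrKA y); exact: absvD_max. Qed.

Lemma absv_sum_le (I : finType) (f : I -> K) (e : R) : 0 <= e ->
  (forall i, absv (f i) <= e) -> absv (\sum_i f i) <= e.
Proof.
move=> e0 fe; apply: (big_ind (fun x => absv x <= e)) => //.
  by rewrite absv0.
by move=> x y xe ye; rewrite (le_trans (absvD_max _ _))// ge_max xe.
Qed.

Lemma absv_le_eq0 x (r : R) : 0 <= r < 1 ->
  (forall n, absv x <= r ^+ n) -> x = 0.
Proof.
move=> r01 xr; apply/eqP; rewrite -absv_eq0 eq_le absv_ge0 andbT.
apply/ler_addgt0Pr => e e0; rewrite add0r.
by have [N /(_ N (leqnn N))] := expr_small r01 e0; exact: le_trans.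
Qed.

Lemma absv_distX_le x y n : absv x <= 1 -> absv y <= 1 ->
  absv (x ^+ n - y ^+ n) <= absv (x - y).
Proof.
move=> x1 y1; rewrite subrXX absvM ler_piMr ?absv_ge0//.
apply: absv_sum_le => // i.
by rewrite absvM !absvX mulr_ile1 ?exprn_ge0 ?absv_ge0 ?exprn_ile1 ?absv_ge0.
Qed.

(** In an ultrametric the first of the successive differences already bounds all later distances, so
    the limit inherits the bound without a geometric sum. *)
Lemma complete_absv_seq (Kcomplete : complete_absv K) (r : R) (x : nat -> K) :
  0 < r < 1 -> (forall i, absv (x i.+1 - x i) <= r ^+ i) ->
  exists l, forall i, absv (x i - l) <= r ^+ i.
Proof.
move=> /andP[r0 r1] xr.
have xd i k : absv (x (i + k)%N - x i) <= r ^+ i.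
  elim: k => [|k IH]; first by rewrite addn0 subrr absv0 exprn_ge0// ltW.
  rewrite (le_trans (absv_dist_max (x (i + k)%N) _ _))// ge_max IH andbT addnS.
  by apply: le_trans (xr _) _; rewrite ler_wiXn2l ?ltW// leq_addr.
have r01 : 0 <= r < 1 by rewrite ltW.
pose y : nat -> abs_space K := x.
have /cvg_ex[l yl] : cvg (y @ \oo).
  apply: Kcomplete; apply: cauchy_exP => e e0.
  have [N /(_ _ (leqnn N)) hN] := expr_small r01 e0.
  (* Balls are defined by a strict inequality; centring at index [N.+1] gives distances at most
     [r ^+ N.+1 < r ^+ N]. *)
  exists (y N.+1); exists N.+1 => // n /= Nn.
  rewrite ballEmdist /= -[mdist _ _]/(absv (x N.+1 - x n)) absv_distC.
  rewrite -(subnKC Nn) (le_lt_trans (xd _ _))//.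
  by apply: lt_le_trans hN; rewrite exprS gtr_pMl ?exprn_gt0.
exists l => i.
have : nbhs (l : abs_space K) (ball (l : abs_space K) (r ^+ i)).
  by apply: nbhsx_ballx; rewrite exprn_gt0.
move=> /yl[N _ hN].
have := hN (i + N)%N (leq_addl _ _).
rewrite /= ballEmdist /= -[mdist _ _]/(absv ((l : K) - x (i + N)%N)) => lx.
rewrite (le_trans (absv_dist_max (x (i + N)%N) _ _))// ge_max.
by rewrite (absv_distC (x i)) xd absv_distC ltW.
Qed.

End Ultrametric.

(** * Discreteness of the absolute value and contraction by the power map *)

Section LocalField.
Variables (R : realType) (K : nonArchFieldType R).
Hypothesis Kcomplete : complete_absv K.
Variables (w : uniformizer K) (q : nat).
Hypothesis card_residue : ([set: residue_field w] #= `I_q)%card.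
Hypothesis absv_unif : absv (\val (unif w)) = q%:R^-1.
Implicit Types x y : K.

Let Q : R := q%:R.
Let pi : K := \val (unif w).

Lemma residue_card_gt0 : (0 < q)%N.
Proof.
have [res [_ [resq _ _ _]]] := residue_system card_residue.
exact: leq_ltn_trans (resq 0).
Qed.

Lemma residue_card_gt1 : (1 < q)%N.
Proof.
rewrite ltnNge; apply/negP => q1; have := unif_lt1 w.
have -> : absv (\val (unif w)) = 1.
  rewrite absv_unif (_ : q = 1%N) ?invr1//.
  by apply/eqP; rewrite eqn_leq q1 residue_card_gt0.
by rewrite ltxx.
Qed.

Let Q_gt1 : 1 < Q. Proof. by rewrite /Q ltr1n residue_card_gt1. Qed.
Let Q_gt0 : 0 < Q. Proof. exact: lt_trans Q_gt1. Qed.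
Let QV_gt0 : 0 < Q^-1. Proof. by rewrite invr_gt0. Qed.
Let QV_ge0 : 0 <= Q^-1. Proof. exact: ltW. Qed.
Let QV_lt1 : Q^-1 < 1. Proof. by rewrite invf_lt1. Qed.
Let QV_itv : 0 <= Q^-1 < 1. Proof. by rewrite QV_ge0. Qed.
Let QV_le1 : Q^-1 <= 1. Proof. exact: ltW. Qed.

Let pi_neq0 : pi != 0.
Proof. by rewrite -absv_eq0 absv_unif gt_eqF. Qed.

Lemma absv_lt1_le x : absv x < 1 -> absv x <= Q^-1.
Proof.
move=> x1.
have [y xy] := @unif_gen _ _ w (Sub x (ltW x1) : valuation_ring K) x1.
rewrite [x](congr1 \val xy : x = pi * \val y) absvM absv_unif.
by rewrite ler_piMr//; exact: (valP y).
Qed.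

(** Division by [pi] multiplies the absolute value by [Q]. By [absv_lt1_le] it keeps elements of
    absolute value below 1 integral, and [N] bounds the number of divisions before the value 1 is
    reached. *)
Lemma absv_valueE x : 0 < absv x <= 1 -> exists m, absv x = Q ^- m.
Proof.
move=> /andP[x0 x1].
have [N hN] : exists N, Q ^- N < absv x.
  have [N /(_ N (leqnn N))] := expr_small QV_itv (midf_lt x0).1.
  rewrite exprVn => hN; exists N; exact: le_lt_trans hN (midf_lt x0).2.
elim: N x x0 x1 hN => [|N IH] x x0 x1.
  by rewrite expr0 invr1 ltNge x1.
move=> hN; have := x1; rewrite le_eqVlt => /predU1P[->|xlt1].
  by exists 0%N; rewrite expr0 invr1.
have xE : absv x = Q^-1 * absv (x / pi).
  by rewrite -absv_unif -absvM mulrC divfK.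
have xpi : absv (x / pi) = Q * absv x by rewrite xE mulVKf ?gt_eqF.
have [|||m mE] := IH (x / pi).
- by rewrite xpi mulr_gt0.
- by rewrite xpi -ler_pdivlMl// mulr1; exact: absv_lt1_le.
- by rewrite xpi -ltr_pdivrMl// -invfM -exprS.
by exists m.+1; rewrite xE mE exprS invfM.
Qed.

(** The cofactor of [x - y] in [x ^+ q - y ^+ q] is congruent to [q%:R * x ^+ q.-1], since [y] is
    congruent to [x], and [q%:R] vanishes in the residue field. *)
Lemma absv_frobenius_contract x y : absv x <= 1 -> absv (x - y) <= Q^-1 ->
  absv (x ^+ q - y ^+ q) <= Q^-1 * absv (x - y).
Proof.
move=> x1 xy; have y1 : absv y <= 1.
  rewrite -[y](subKr x) (le_trans (absvB_max _ _))// ge_max x1.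
  exact: le_trans xy QV_le1.
rewrite subrXX absvM mulrC ler_wpM2r ?absv_ge0//.
have -> : \sum_(i < q) x ^+ (q.-1 - i) * y ^+ i =
    \sum_(i < q) x ^+ (q.-1 - i) * (y ^+ i - x ^+ i) + q%:R * x ^+ q.-1.
  rewrite -[q in q%:R]card_ord -sum1_card natr_sum big_distrl -big_split/=.
  apply: eq_bigr => i _; rewrite mulrBr -exprD subnK; last first.
    by rewrite -ltnS prednK ?ltn_ord// residue_card_gt0.
  by rewrite mul1r subrK.
rewrite (le_trans (absvD_max _ _))// ge_max; apply/andP; split.
  apply: absv_sum_le => // i.
  rewrite absvM absvX -[leRHS]mul1r ler_pM ?exprn_ge0 ?absv_ge0//.
    by rewrite exprn_ile1 ?absv_ge0.
  by rewrite (le_trans (absv_distX_le _ _ _))// absv_distC.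
rewrite absvM absvX -[leRHS]mulr1 ler_pM ?absv_ge0 ?exprn_ge0 ?absv_ge0//.
  by apply: absv_lt1_le; exact: absv_card_lt1 card_residue.
by rewrite exprn_ile1 ?absv_ge0.
Qed.

(** * Digit expansions in the valuation ring *)

Variables (res : K -> nat) (rep : nat -> K).
Hypothesis res_lt : forall x, (res x < q)%N.
Hypothesis rep_le1 : forall i, absv (rep i) <= 1.
Hypothesis repK : forall i, (i < q)%N -> res (rep i) = i.
Hypothesis res_eqE : forall x y, absv x <= 1 -> absv y <= 1 ->
  res x = res y <-> absv (x - y) < 1.

Definition padic_shift x := (x - rep (res x)) / pi.

Definition padic_digit x (i : nat) := res (iter i padic_shift x).

Let absv_shift x : absv x <= 1 -> absv (padic_shift x) <= 1.
Proof.
move=> x1; rewrite /padic_shift absvM absvV absv_unif invrK -ler_pdivlMr// mul1r.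
by apply: absv_lt1_le; apply/res_eqE => //; rewrite repK.
Qed.

(** Equal leading digits cancel, so the distance is [Q^-1] times that of the shifts; and leading
    digits agree exactly when the distance is below 1. *)
Lemma padic_digitP x y n : absv x <= 1 -> absv y <= 1 ->
  (forall i, (i < n)%N -> padic_digit x i = padic_digit y i) <->
  absv (x - y) <= Q ^- n.
Proof.
elim: n x y => [|n IH] x y x1 y1.
  by split => // _; rewrite expr0 invr1 (le_trans (absvB_max _ _))// ge_max x1.
have shiftE : res x = res y ->
    absv (x - y) = Q^-1 * absv (padic_shift x - padic_shift y).
  move=> xy; rewrite -absv_unif -absvM; congr absv.
  by rewrite /padic_shift xy; field.
rewrite exprS invfM; split=> [dxy|].
  rewrite shiftE; last exact: dxy 0%N _.
  rewrite ler_pM2l//; apply/IH; [exact: absv_shift..|].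
  by move=> i iln; have := dxy i.+1 iln; rewrite /padic_digit !iterSr.
move=> xy; have rxy : res x = res y.
  apply/res_eqE => //; apply: le_lt_trans xy _.
  by rewrite (le_lt_trans _ QV_lt1)// ler_piMr// -exprVn exprn_ile1.
move: xy; rewrite shiftE// ler_pM2l// => /IH dxy [_|i iln]; first exact: rxy.
rewrite /padic_digit !iterSr; apply: dxy => //; exact: absv_shift.
Qed.

(** Finite digit words are realized by prepending digits, as in [rep (c 0) + pi * x]; completeness
    then gives the infinite word. *)
Lemma padic_digit_surj (c : nat -> nat) : (forall i, (c i < q)%N) ->
  exists2 x, absv x <= 1 & forall i, padic_digit x i = c i.
Proof.
move=> cq.
have /choice[s sP] : forall n, exists x, absv x <= 1 /\
    forall i, (i < n)%N -> padic_digit x i = c i.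
  move=> n; elim: n c cq => [|n IH] c cq.
    by exists 0; rewrite absv0.
  have [x [x1 xc]] := IH (fun i => c i.+1) (fun i => cq i.+1).
  have pix : absv (pi * x) < 1.
    by rewrite absvM absv_unif (le_lt_trans _ QV_lt1)// ler_piMr.
  have y1 : absv (rep (c 0%N) + pi * x) <= 1.
    by rewrite (le_trans (absvD_max _ _))// ge_max rep_le1 ltW.
  have resy : res (rep (c 0%N) + pi * x) = c 0%N.
    by rewrite -[RHS]repK//; apply/res_eqE => //; rewrite addrAC subrr add0r.
  exists (rep (c 0%N) + pi * x); split => // -[_|i iln]; first exact: resy.
  have shy : padic_shift (rep (c 0%N) + pi * x) = x.
    by rewrite /padic_shift resy addrAC subrr add0r mulrC mulKf.
  by rewrite /padic_digit iterSr shy; exact: xc.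
have [||x xs] := complete_absv_seq (r := Q^-1) Kcomplete (x := s).
- by rewrite QV_gt0.
- move=> i; rewrite exprVn.
  have [s1 sc] := sP i.+1; have [s1' sc'] := sP i.
  by apply/padic_digitP => // j ji; rewrite sc ?sc'// ltnW.
have x1 : absv x <= 1.
  rewrite -[x](subKr (s 0%N)) (le_trans (absvB_max _ _))// ge_max.
  by rewrite (sP 0%N).1; have := xs 0%N; rewrite expr0.
exists x => // i; have [s1 sc] := sP i.+1; rewrite -(sc i)//; apply/esym.
have := xs i.+1; rewrite exprVn => /(padic_digitP _ s1 x1); exact.
Qed.

(** * Backward orbits with prescribed residues *)

Variables (a b : K) (m : nat).
Hypothesis absv_a : absv a = Q ^- m.
Hypothesis absv_b : absv b = Q.

Let b_neq0 : b != 0. Proof. by rewrite -absv_eq0 absv_b gt_eqF. Qed.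
Let a_neq0 : a != 0.
Proof. by rewrite -absv_eq0 absv_a invr_eq0 expf_neq0 ?gt_eqF. Qed.
Let absv_a_le1 : absv a <= 1.
Proof. by rewrite absv_a -exprVn exprn_ile1. Qed.

Definition backward_orbit (x : nat -> K) := (forall n, absv (x n) <= 1) /\
  forall n, x n = a * x n.+2 + b * (x n.+1 ^+ q - x n.+1).

(* The backward orbits with given [x 0] are the fixed points of this map. *)
Definition orbit_step (x0 : K) (x : nat -> K) (n : nat) : K :=
  if n is n'.+1 then x n ^+ q + (a * x n.+1 - x n') / b else x0.

Let step_diff x y : absv ((a * x - y) / b) <= Q^-1 * Num.max (absv x) (absv y).
Proof.
rewrite absvM absvV absv_b mulrC ler_pM2l//.
rewrite (le_trans (absvB_max _ _))// ge_max !le_max lexx orbT andbT absvM.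
by rewrite ler_piMl ?absv_ge0.
Qed.

(** The power map contracts by [absv_frobenius_contract], the linear part because [absv b = Q] and
    [absv a <= 1]. *)
Lemma orbit_step_contract x0 (x y : nat -> K) e : e <= Q^-1 ->
  (forall n, absv (x n) <= 1) -> (forall n, absv (x n - y n) <= e) ->
  forall n, absv (orbit_step x0 x n - orbit_step x0 y n) <= Q^-1 * e.
Proof.
move=> eQ x1 xye [|n] /=.
  by rewrite subrr absv0 mulr_ge0// (le_trans (absv_ge0 _) (xye 0%N)).
have -> : x n.+1 ^+ q + (a * x n.+2 - x n) / b -
    (y n.+1 ^+ q + (a * y n.+2 - y n) / b) = (x n.+1 ^+ q - y n.+1 ^+ q) +
    (a * (x n.+2 - y n.+2) - (x n - y n)) / b by field.
rewrite (le_trans (absvD_max _ _))// ge_max; apply/andP; split.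
  apply: le_trans (absv_frobenius_contract _ _) _ => //.
    exact: le_trans (xye _) eQ.
  by rewrite ler_pM2l.
apply: le_trans (step_diff _ _) _.
by rewrite ler_pM2l// ge_max !xye.
Qed.

(** Picard iteration starts from a sequence with the prescribed residues. A step changes each term
    by less than 1 in absolute value, so the residues persist. *)
Lemma backward_orbit_exists x0 (c : nat -> nat) :
  absv x0 <= 1 -> (forall i, (c i < q)%N) ->
  exists x : nat -> K, [/\ backward_orbit x, x 0%N = x0 & forall n, res (x n.+1) = c n].
Proof.
move=> x01 cq.
pose s i := iter i (orbit_step x0) (fun n => if n is n'.+1 then rep (c n') else x0).
have s0 i : s i 0%N = x0 by case: i.
have sP i n : absv (s i n) <= 1 /\ (res (s i n.+1) = c n).
  elim: i n => [|i IH] n; first by case: n => [|n]; rewrite /= repK.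
  have step j : absv (s i.+1 j.+1 - s i j.+1) < 1.
    rewrite /= -/(s i) addrAC (le_lt_trans (absvD_max _ _))// gt_max.
    rewrite (absv_frobenius_lt1 card_residue) ?(IH _).1//=.
    apply: le_lt_trans (step_diff _ _) (le_lt_trans _ QV_lt1).
    by rewrite ler_piMr// ge_max !(IH _).1.
  have le1 j : absv (s i.+1 j) <= 1.
    case: j => [|j]; first by rewrite s0.
    rewrite -[s i.+1 _](subrK (s i j.+1)) (le_trans (absvD_max _ _))// ge_max.
    by apply/andP; split; [exact: ltW|exact: (IH _).1].
  split => //; rewrite -(IH n).2; apply/res_eqE => //; exact: (IH _).1.
(* The exponent is [i.+1] because [orbit_step_contract] requires an initial bound of at most [Q^-1];
   equal residues provide it. *)
have sd i n : absv (s i.+1 n - s i n) <= Q^-1 ^+ i.+1.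
  elim: i n => [|i IH] n.
    rewrite expr1; apply: absv_lt1_le; case: n => [|n].
      by rewrite !s0 subrr absv0.
    by apply/res_eqE; rewrite ?(sP _ _).1 ?(sP _ _).2.
  rewrite exprS; apply: orbit_step_contract IH _ => [|j]; last exact: (sP _ _).1.
  by rewrite exprS ler_piMr// exprn_ile1.
have /choice[x xP] : forall n, exists l, forall i, absv (s i n - l) <= Q^-1 ^+ i.
  move=> n; apply: (complete_absv_seq Kcomplete); first by rewrite QV_gt0.
  by move=> i; apply: le_trans (sd i n) _; rewrite ler_wiXn2l.
have x1 n : absv (x n) <= 1.
  rewrite -[x n](subKr (s 0%N n)) (le_trans (absvB_max _ _))// ge_max (sP _ _).1.
  by have := xP n 0%N; rewrite expr0.
have xE n : x n = orbit_step x0 x n.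
  (* Both [x] and its image under the step are within [Q^-1 ^+ i] of the iterate [s i.+2], for every
     [i]. *)
  apply/eqP; rewrite -subr_eq0; apply/eqP; apply: (absv_le_eq0 QV_itv) => i.
  rewrite (le_trans (absv_dist_max (s i.+2 n) _ _))// ge_max; apply/andP; split.
    by rewrite absv_distC (le_trans (xP _ _))// ler_wiXn2l// leqW.
  apply: (@le_trans _ _ (Q^-1 * Q^-1 ^+ i.+1)).
    apply: (orbit_step_contract x0 (x := s i.+1)) => [|j|j]; last exact: xP.
      by rewrite exprS ler_piMr// exprn_ile1.
    exact: (sP _ _).1.
  by rewrite -exprS ler_wiXn2l// leqW.
exists x; split; first split=> // n.
- by have := xE n.+1; rewrite /= => {2}->; field.
- exact: xE.
(* The comparison is with [s 1], as the bound [Q^-1 ^+ i] is below 1 only from [i = 1] on. *)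
- move=> n; rewrite -(sP 1%N n).2; apply/res_eqE => //; first exact: (sP _ _).1.
  by rewrite absv_distC (le_lt_trans (xP _ _))// expr1.
Qed.

Let shrink_le0 (d t : R) : t < 1 -> 0 <= d -> d <= t * d -> d = 0.
Proof.
move=> t1 d0 dtd; apply/eqP; rewrite eq_le d0 andbT leNgt; apply/negP => dgt0.
by move: dtd; rewrite ler_pMl// leNgt t1.
Qed.

(** By induction on the shifted sequence, [D 2] is at most [t * D 1] or [r ^+ n]. When
    [D 1 <= r * D 2], the first case gives [D 1 <= r * t * D 1], hence [D 1 = 0], and the second
    gives the power of [r]. *)
Lemma three_term_decay (D : nat -> R) (t r : R) n :
  0 <= t < 1 -> 0 <= r <= 1 -> (forall i, 0 <= D i) ->
  (forall i, (i < n)%N -> D i.+1 <= Num.max (t * D i) (r * D i.+2)) ->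
  D n.+1 <= 1 -> D 1%N <= Num.max (t * D 0%N) (r ^+ n).
Proof.
move=> /andP[t0 t1] /andP[r0 r1].
elim: n D => [|n IH] D D0 DD Dn; first by rewrite expr0 le_max Dn orbT.
have := IH (fun i => D i.+1) (fun i => D0 i.+1) (fun i => DD i.+1) Dn.
rewrite !le_max => D2.
have /orP[->//|D1] : (D 1%N <= t * D 0%N) || (D 1%N <= r * D 2%N).
  by rewrite -le_max; exact: DD.
move: D2 => /orP[D2|D2]; last first.
  by apply/orP; right; rewrite exprS (le_trans D1)// ler_wpM2l.
have -> : D 1%N = 0.
  apply: (shrink_le0 (t := r * t)) => //.
    by rewrite (le_lt_trans _ t1)// ler_piMl.
  by rewrite (le_trans D1)// -mulrA ler_wpM2l.
by rewrite mulr_ge0.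
Qed.

(** [Q ^- M] is the absolute value of [a / b]. *)
Let M := m.+1.
Let L := M.+1.

(** * Distance between two backward orbits *)

Section OrbitDistance.
Variables (x y : nat -> K).
Hypotheses (xO : backward_orbit x) (yO : backward_orbit y).
Let D n := absv (x n - y n).

(** Subtract the two recurrences, solved for the middle term. The difference of [q]-th powers is at
    most [Q^-1 * D n.+1], too small to account for [D n.+1] unless that is 0. *)
Lemma orbit_dist_le n : res (x n.+1) = res (y n.+1) ->
  D n.+1 <= Num.max (Q^-1 * D n) (Q ^- M * D n.+2).
Proof.
move=> /(iffLR (res_eqE (xO.1 _) (yO.1 _)))/absv_lt1_le xy.
pose e := (a * (x n.+2 - y n.+2) - (x n - y n)) / b.
have De : D n.+1 <= Num.max (Q^-1 * D n.+1) (absv e).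
  rewrite /D; have {1}-> : x n.+1 - y n.+1 = (x n.+1 ^+ q - y n.+1 ^+ q) + e.
    by rewrite /e (xO.2 n) (yO.2 n); field.
  rewrite (le_trans (absvD_max _ _))// ge_max !le_max lexx orbT andbT.
  by rewrite absv_frobenius_contract// xO.1.
have {De} : D n.+1 <= absv e.
  move: De; rewrite le_max => /orP[/shrink_le0 -> //|//]; exact: absv_ge0.
move=> /le_trans; apply; rewrite /e absvM absvV absv_b mulrC.
rewrite exprS invfM -absv_a -mulrA -absvM maxC -maxr_pMr//.
by rewrite ler_pM2l//; exact: absvB_max.
Qed.

(** Here the recurrence is solved for its last term, which costs the factor
    [absv (b / a) = Q ^+ M]. *)
Lemma orbit_dist_expand n :
  D n.+2 <= Q ^+ M * Num.max (D n) (D n.+1).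
Proof.
have : absv a * D n.+2 <= Q * Num.max (D n) (D n.+1).
  rewrite -absvM (_ : a * (x n.+2 - y n.+2) = (x n - y n) -
      b * ((x n.+1 ^+ q - y n.+1 ^+ q) - (x n.+1 - y n.+1))); last first.
    by rewrite (xO.2 n) (yO.2 n); ring.
  rewrite (le_trans (absvB_max _ _))// ge_max; apply/andP; split.
    apply: (@le_trans _ _ (Num.max (D n) (D n.+1))); first by rewrite le_max lexx.
    by rewrite ler_peMl ?le_max ?absv_ge0// ltW.
  rewrite absvM absv_b ler_pM2l// (le_trans (absvB_max _ _))// ge_max !le_max.
  by rewrite lexx (absv_distX_le _ (xO.1 _) (yO.1 _)) !orbT.
by rewrite absv_a ler_pdivrMl ?exprn_gt0// mulrA -exprSr.
Qed.

Lemma orbit_dist_iter n k : (k <= n)%N ->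
  Num.max (D 0%N) (D 1%N) <= Q ^- (M * n) ->
  Num.max (D k) (D k.+1) <= Q ^- (M * (n - k)).
Proof.
elim: k => [|k IH] kn D01; first by rewrite subn0.
have := IH (ltnW kn) D01; rewrite -(subnSK kn).
set e := (n - k.+1)%N => Dk.
have QM : Q ^+ M * Q ^- (M * e.+1) = Q ^- (M * e).
  by rewrite mulnS exprD invfM mulrA mulfV ?mul1r// expf_neq0 ?gt_eqF.
rewrite ge_max; apply/andP; split; last first.
  by rewrite (le_trans (orbit_dist_expand _))// -QM ler_pM2l ?exprn_gt0.
move: Dk; rewrite ge_max => /andP[_ Dk]; apply: le_trans Dk _.
rewrite lef_pV2 ?posrE ?exprn_gt0// ler_weXn2l ?ltW// leq_mul2l.
by rewrite leqnSn orbT.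
Qed.

(** Forwards, [three_term_decay] applies with [t = Q^-1] and [r = Q ^- M], closed at the far end by
    [D n.+1 <= 1]. Backwards, [orbit_dist_iter] keeps [D i.+1] below 1 for [i < n], so residues
    agree. *)
Lemma orbit_digits_dist n :
  D 0%N <= Q ^- (M * n) /\ (forall i, (i < n)%N -> res (x i.+1) = res (y i.+1)) <->
  Num.max (D 0%N) (D 1%N) <= Q ^- (M * n).
Proof.
split=> [[D0 rxy]|D01].
  rewrite ge_max D0/=.
  apply: (@le_trans _ _ (Num.max (Q^-1 * D 0%N) (Q ^- M ^+ n))).
    apply: three_term_decay => [|||i /rxy|] //; last 1 first.
    - by rewrite (le_trans (absvB_max _ _))// ge_max xO.1 yO.1.
    - by rewrite -exprVn exprn_ge0// exprn_ile1.
    - by move=> i; exact: absv_ge0.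
    - exact: orbit_dist_le.
  rewrite -!exprVn -exprM exprVn ge_max lexx andbT (le_trans _ D0)//.
  by rewrite ler_piMl ?absv_ge0.
split; first by move: D01; rewrite ge_max => /andP[].
move=> i iln; apply/res_eqE; rewrite ?xO.1 ?yO.1//.
have := orbit_dist_iter (ltnW iln) D01; rewrite ge_max => /andP[_] /le_lt_trans.
apply; rewrite -exprVn exprn_ilt1// muln_eq0/= -lt0n subn_gt0//.
Qed.

End OrbitDistance.

(* Blocks of [M] digits of [x 0] followed by one residue of [x n], [n >= 1]. *)
Definition orbit_digit (x : nat -> K) (i : nat) : nat :=
  if (i %% L < M)%N then padic_digit (x 0%N) (M * (i %/ L) + i %% L)
  else res (x (i %/ L).+1).

Lemma orbit_digit_x0 (x : nat -> K) k :
  orbit_digit x (L * (k %/ M) + k %% M) = padic_digit (x 0%N) k.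
Proof.
have kM : (k %% M < M)%N by rewrite ltn_pmod.
rewrite /orbit_digit [(L * _)%N]mulnC modnMDl divnMDl//.
rewrite (modn_small (ltnW kM : (_ < L)%N)) (divn_small (ltnW kM : (_ < L)%N)).
by rewrite kM addn0 mulnC -divn_eq.
Qed.

Lemma orbit_digit_res (x : nat -> K) j : orbit_digit x (L * j + M) = res (x j.+1).
Proof.
rewrite /orbit_digit [(L * _)%N]mulnC modnMDl divnMDl//.
by rewrite modn_small// divn_small// ltnn addn0.
Qed.

Lemma orbit_digit_lt (x : nat -> K) i : (orbit_digit x i < q)%N.
Proof. by rewrite /orbit_digit; case: ifP => _; exact: res_lt. Qed.

(** The first [n] blocks hold exactly the first [M * n] digits of [x 0] and the residues of [x 1] to
    [x n], which reduces this to [orbit_digits_dist]. *)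
Lemma orbit_digitP (x y : nat -> K) n : backward_orbit x -> backward_orbit y ->
  (forall i, (i < L * n)%N -> orbit_digit x i = orbit_digit y i) <->
  Num.max (absv (x 0%N - y 0%N)) (absv (x 1%N - y 1%N)) <= Q ^- (M * n).
Proof.
move=> xO yO; rewrite -orbit_digits_dist//; split=> [dE|[x0y0 rE] i iLn].
  split=> [|j jn]; last first.
    rewrite -!orbit_digit_res; apply: dE.
    by rewrite (leq_trans (_ : _ < L * j.+1)%N) ?leq_mul2l// mulnS addnC ltn_add2r.
  apply/padic_digitP => [||k kMn]; [exact: xO.1|exact: yO.1|].
  rewrite -!orbit_digit_x0; apply: dE.
  have kn : (k %/ M < n)%N by rewrite ltn_divLR// mulnC.
  rewrite (leq_trans (_ : _ < L * (k %/ M).+1)%N) ?leq_mul2l//.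
  by rewrite mulnS addnC ltn_add2r leqW// ltn_pmod.
have iL : (i %/ L < n)%N by rewrite ltn_divLR// mulnC.
rewrite /orbit_digit; case: ifP => iM; last exact: rE.
move: x0y0 => /padic_digitP; apply; rewrite ?xO.1 ?yO.1//.
rewrite (leq_trans (_ : _ < M * (i %/ L).+1)%N) ?leq_mul2l//.
by rewrite mulnS addnC ltn_add2r.
Qed.

Lemma orbit_digit_surj (c : nat -> nat) : (forall i, (c i < q)%N) ->
  exists2 x : nat -> K, backward_orbit x & forall i, orbit_digit x i = c i.
Proof.
move=> cq.
have [x0 x01 x0c] := padic_digit_surj (fun k => cq (L * (k %/ M) + k %% M)%N).
have [x [xO xx0 xc]] := backward_orbit_exists x01 (fun j => cq (L * j + M)%N).
exists x => // i; rewrite /orbit_digit; case: ifP => iM.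
  rewrite xx0 x0c [(M * _)%N]mulnC divnMDl// modnMDl.
  rewrite (modn_small iM) (divn_small iM) addn0.
  by rewrite mulnC -divn_eq.
rewrite xc; congr c; rewrite [RHS](divn_eq i L) mulnC; congr addn.
by apply/eqP; rewrite eqn_leq leqNgt iM/= -ltnS ltn_pmod.
Qed.

(** * The attractor as the set of backward orbits *)

Definition henon_back (u : K * K) : K * K :=
  (u.2, (u.1 - b * (u.2 ^+ q - u.2)) / a).

Definition orbit_of (u : K * K) (n : nat) : K := (iter n henon_back u).1.

Lemma henon_mapK : cancel (henon_map q a b) henon_back.
Proof. by case=> u v; rewrite /henon_back /henon_map /= addrK mulrC mulKf. Qed.

Lemma henon_backK : cancel henon_back (henon_map q a b).
Proof.
by case=> u v; rewrite /henon_back /henon_map /= mulrC divfK// subrK.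
Qed.

Lemma orbit_of2 u n : iter n henon_back u = (orbit_of u n, orbit_of u n.+1).
Proof. by rewrite /orbit_of iterS /=; case: (iter n _ u). Qed.

(** The map is invertible, so [u] lies in the [n]-th image of the bidisk iff its [n]-th preimage,
    the pair of terms [n] and [n.+1] of its orbit, is integral. *)
Lemma attractorP u :
  attractor (henon_map q a b) u <-> backward_orbit (orbit_of u).
Proof.
have iterK n : cancel (iter n (henon_map q a b)) (iter n henon_back).
  by elim: n => // n IH v; rewrite iterSr iterS henon_mapK IH.
have iterK' n : cancel (iter n henon_back) (iter n (henon_map q a b)).
  by elim: n => // n IH v; rewrite iterSr iterS henon_backK IH.
split=> [uA|[u1 _] n _]; last first.
  exists (iter n henon_back u); last exact: iterK'.
  by rewrite orbit_of2; split; exact: u1.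
split=> [[|n]|n].
(* The intersection starts at [n = 1], so integrality of term 0 needs an argument: [v.1 ^+ q - v.1]
   has absolute value at most [Q^-1], which offsets [absv b = Q]. *)
- have [v [v1 v2] <-] := uA 1%N isT.
  rewrite /orbit_of /= (le_trans (absvD_max _ _))// ge_max !absvM.
  rewrite mulr_ile1 ?absv_ge0//= absv_b -ler_pdivlMl// mulr1.
  by apply: absv_lt1_le; exact: absv_frobenius_lt1 card_residue _ _.
- have [v [v1 v2] <-] := uA n.+1 isT.
  by rewrite /orbit_of iterK.
- rewrite /orbit_of !iterS; case: (iter n _ u) => s t /=.
  by rewrite mulrC divfK// subrK.
Qed.

Lemma orbit_of_orbit (x : nat -> K) n :
  backward_orbit x -> orbit_of (x 0%N, x 1%N) n = x n.
Proof.
move=> [_ xE].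
suff /(congr1 fst) : iter n henon_back (x 0%N, x 1%N) = (x n, x n.+1) by [].
elim: n => // n IH; rewrite iterS IH /henon_back /=.
by congr pair; rewrite {1}(xE n) addrK mulrC mulKf.
Qed.

Lemma hausdorff_dim_attractor :
  hausdorff_dim (attractor (henon_map q a b)) (L%:R / M%:R).
Proof.
apply: (@hausdorff_dim_coded R (abs_plane K) _ q L M
  (fun u => orbit_digit (orbit_of u))).
- exact: residue_card_gt1.
- by [].
- by [].
- by move=> u i; exact: orbit_digit_lt.
- move=> n u v /attractorP uA /attractorP vA.
  by move/(orbit_digitP _ uA vA).
- move=> n u v /attractorP uA /attractorP vA uv.
  by apply/(orbit_digitP _ uA vA).
- move=> c /orbit_digit_surj[x xO xc]; exists (x 0%N, x 1%N).
    apply/attractorP; rewrite (_ : orbit_of _ = x)//.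
    by apply/funext => n; exact: orbit_of_orbit.
  by move=> i; rewrite -xc; congr orbit_digit; apply/funext => n; exact: orbit_of_orbit.
Qed.

End LocalField.

Theorem theorem3 (R : realType) (K : nonArchFieldType R)
    (Kntriv : nontrivial_absv K) (Kcomplete : complete_absv K)
    (Klc : locally_compact [set: abs_space K])
    (w : uniformizer K) (q : nat)
    (card_residue : ([set: residue_field w] #= `I_q)%card)
    (absv_unif : absv (\val (unif w)) = q%:R^-1)
    (a b : K) (a_gt0 : 0 < absv a) (a_lt1 : absv a < 1)
    (b_q : absv b = q%:R) :
  hausdorff_dim (attractor (henon_map q a b))
    (1 + 1 / (1 + ln (1 / absv a) / ln q%:R)).
Proof.
have a01 : 0 < absv a <= 1 by rewrite a_gt0 ltW.
have [m aE] := absv_valueE card_residue absv_unif a01.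
have [res [rep [res_lt rep_le1 repK res_eqE]]] := residue_system card_residue.
have q1 : 1 < q%:R :> R by rewrite ltr1n (residue_card_gt1 card_residue absv_unif).
(* The quotient of logarithms is [m], and [1 + 1 / (1 + m)] equals [m.+2 / m.+1]. *)
rewrite aE !div1r invrK lnXn; last exact: lt_trans q1.
rewrite -[ln _ *+ _]mulr_natl mulfK ?gt_eqF ?ln_gt0//.
rewrite (_ : 1 + (1 + m%:R)^-1 = m.+2%:R / m.+1%:R); last first.
  by rewrite -[m.+2%:R]natr1 -[m.+1%:R]natr1; field; rewrite natr1 pnatr_eq0.
exact: (hausdorff_dim_attractor Kcomplete card_residue absv_unif
  res_lt rep_le1 repK res_eqE aE b_q).
Qed.
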